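(* Let $r>1$, $\rho>0$, let $\ell$ be slowly varying at infinity, and let $u:[0,\infty)\to[0,\infty)$ be measurable with $U(x)=\int_0^xu(y)\,\mathrm{d}y<\infty$ for all $x\ge0$. Assume that for some $p_0\in\mathcal{P}_r$ $$\lim_{n\to\infty}\frac{u(r^nz)}{(r^nz)^{\rho-1}\,\ell(r^nz)}=p_0(z)\quad\text{for each } z\in C_{p_0},$$ and that $$\limsup_{x\to\infty}\frac{u(x)}{x^{\rho-1}\ell(x)}<\infty.$$ Then $$U(x)=\int_0^xu(y)\,\mathrm{d}y\sim x^\rho\,\ell(x)\,p(x)\quad\text{as } x\to\infty,$$ where $p=\mathrm{B}_\rho p_0$.
   Context: A function $\ell:(0,\infty)\to(0,\infty)$ is slowly varying at infinity if it is measurable and $\ell(\lambda x)/\ell(x)\to1$ as $x\to\infty$ for every $\lambda>0$. For $r>1$, $\mathcal{P}_r$ is the set of functions $p:(0,\infty)\to(0,\infty)$ that are bounded, right-continuous, satisfy $\inf_{x\in[1,r]}p(x)>0$, and $p(xr)=p(x)$ for all $x>0$. $C_p$ is the set of continuity points of $p$. For $\rho>0$ and $p\in\mathcal{P}_r$, $\mathrm{B}_\rho p(x)=x^{-\rho}\int_0^xy^{\rho-1}p(y)\,\mathrm{d}y$, $x>0$. $f\sim g$ means $f/g\to1$. *)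

(* Defs.v *)
From HB Require Import structures.
From mathcomp Require Import all_boot all_order all_algebra.
From mathcomp Require Import all_classical all_reals all_analysis.

Set Implicit Arguments.
Unset Strict Implicit.
Unset Printing Implicit Defensive.

Import Order.TTheory GRing.Theory Num.Theory.
Import numFieldNormedType.Exports.

Local Open Scope classical_set_scope.
Local Open Scope ring_scope.

(* A function on (0,oo) or [0,oo) is represented by a total function R -> R;
   every condition below only constrains its values on the intended domain. *)

Definition slowly_varying (R : realType) (l : R -> R) : Prop :=
  [/\ measurable_fun (`]0, +oo[ : set R) l,
      forall x : R, 0 < x -> 0 < l x
    & forall lambda : R, 0 < lambda -> l (lambda * x) / l x @[x --> +oo] --> (1 : R)].

Definition periodicP (R : realType) (r : R) (p : R -> R) : Prop :=
  [/\ forall x : R, 0 < x -> 0 < p x,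
      [bounded p x | x in `]0, +oo[],
      forall x : R, 0 < x -> p y @[y --> x^'+] --> p x,
      0 < inf (p @` `[1, r])
    & forall x : R, 0 < x -> p (x * r) = p x].

(* The points are interior to (0,oo), so continuity of the total function at
   such a point is continuity of its restriction to (0,oo). *)
Definition continuity_points (R : realType) (p : R -> R) : set R :=
  [set x | 0 < x /\ {for x, continuous p}].

Definition B_op (R : realType) (rho : R) (p : R -> R) (x : R) : R :=
  x `^ (- rho) *
  \int[lebesgue_measure]_(y in `]0, x]) (y `^ (rho - 1) * p y).

Definition asymp_equiv (R : realType) (f g : R -> R) : Prop :=
  f x / g x @[x --> +oo] --> (1 : R).

(* Main.v *)
(* Put [W x = U x / (x^rho l(x))], [B = B_rho p0] and [th = r^-rho < 1]. Splitting
   both integrals at [x/r], and using that [B] is invariant under [x -> x/r],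
     W(x) - B(x) = th (l(x/r)/l(x)) (W(x/r) - B(x/r)) + b(x),
   so it suffices that [b] tends to 0 and that [W - B] is bounded on compact sets
   far out: the recursion is then a contraction. Both facts rest on the uniform
   convergence theorem for [l]. In [b], the integral over [(x/r, x]] is controlled
   by the mean of [|f - p0|], where [f y = u y / (y^(rho-1) l y)]; rescaling by
   [r^n] puts it on the fixed interval [(1/r, r]], where dominated convergence
   applies because a right-continuous function has only countably many
   discontinuities. Working on one period block at a time avoids Potter bounds. *)

Require Import Defs.
From HB Require Import structures.
From mathcomp Require Import all_boot all_order all_algebra.
From mathcomp Require Import all_classical all_reals all_analysis.
From mathcomp Require Import measurable_realfun ring lra.

Set Implicit Arguments.
Unset Strict Implicit.
Unset Printing Implicit Defensive.

Import Order.TTheory GRing.Theory Num.Theory.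
Import numFieldNormedType.Exports.

Local Open Scope classical_set_scope.
Local Open Scope ring_scope.

(** * Lebesgue measure and integrals under dilations *)

Section scaling.
Context {R : realType}.
Local Notation mu := (@lebesgue_measure R).
Implicit Types a b c : R.

Lemma scale_preimage_itvoc c a b : 0 < c ->
  ( *%R c) @^-1` `]a, b] = `]c^-1 * a, c^-1 * b]%classic.
Proof.
by move=> c0; apply/seteqP; split => x /=;
  rewrite !in_itv/= ltr_pdivrMl// ler_pdivlMl.
Qed.

(** The codomain is displayed as [measurableTypeR R] so that the pushforward of Lebesgue measure
    along [scale c] is typed as a measure on that structure. *)
Let scale c : R -> measurableTypeR R := *%R c.

Let mscale_fun c : measurable_fun [set: R] (scale c).
Proof. exact: mulrl_measurable. Qed.

(** By uniqueness of Lebesgue measure: [c] times the pushforward of [mu] under multiplication by [c]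
    gives every half-open interval its length. *)
Lemma lebesgue_measure_scale c : 0 < c -> forall A : set R, measurable A ->
  mu A = (c%:E * mu (( *%R c) @^-1` A))%E.
Proof.
move=> c0.
pose nu : {measure set (measurableTypeR R) -> \bar R} :=
  measure_function_pushforward__canonical__measure_function_Measure mu (mscale_fun c).
apply: (@lebesgue_measure_unique R (mscale (NngNum (ltW c0)) nu)).
move=> _ [[a b]] _ <-.
transitivity (c%:E * mu (( *%R c) @^-1` `]a, b]))%E; last by [].
rewrite scale_preimage_itvoc// !lebesgue_measure_itv/= !lte_fin.
rewrite ltr_pM2l ?invr_gt0//; case: ifPn => _; last by rewrite mule0.
by rewrite -EFinB -EFinM -mulrBr mulrA mulfV ?gt_eqF// mul1r.
Qed.

Lemma ge0_integral_scale c a b (f : R -> \bar R) : 0 < c ->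
    measurable_fun `]c * a, c * b] f ->
    (forall x, x \in `]c * a, c * b] -> (0 <= f x)%E) ->
  (\int[mu]_(x in `](c * a)%R, (c * b)%R]) f x =
   c%:E * \int[mu]_(x in `]a, b]) f (c * x)%R)%E.
Proof.
move=> c0 mf f0.
pose nu : {measure set (measurableTypeR R) -> \bar R} :=
  measure_function_pushforward__canonical__measure_function_Measure mu (mscale_fun c).
rewrite (@eq_measure_integral _ _ _ _ (mscale (NngNum (ltW c0)) nu)); last first.
  by move=> A mA _; exact: lebesgue_measure_scale.
rewrite ge0_integral_mscale//=.
rewrite ge0_integral_pushforward//=; last 2 first.
- exact: mscale_fun.
- by move=> y; rewrite inE => /f0.
rewrite -[_ @^-1` _]/(( *%R c) @^-1` `]c * a, c * b]) scale_preimage_itvoc//.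
by rewrite !mulrA mulVf ?gt_eqF// !mul1r.
Qed.

Lemma ge0_Rintegral_scale c a b (f : R -> R) : 0 < c ->
    measurable_fun `]c * a, c * b] f ->
    (forall x, x \in `]c * a, c * b] -> 0 <= f x) ->
  \int[mu]_(x in `]c * a, c * b]) f x = c * \int[mu]_(x in `]a, b]) f (c * x).
Proof.
move=> c0 mf f0; rewrite /Rintegral ge0_integral_scale//; last first.
  exact/measurable_EFinP.
have : (0 <= \int[mu]_(x in `]a, b]) (f (c * x)%R)%:E)%E.
  apply: integral_ge0 => x /=; rewrite in_itv/= => /andP[ax xb].
  by rewrite lee_fin f0// in_itv/= ltr_pM2l// ler_pM2l// ax.
(* No integrability is assumed: if the integral is [+oo], both sides are 0, because [fine] sends
   [+oo] to 0. *)
by case: integral => //=; rewrite gt0_muley ?lte_fin//= mulr0.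
Qed.

End scaling.

(** * Integrals of bounded functions on bounded intervals *)

Section bounded_integrals.
Context {R : realType}.
Local Notation mu := (@lebesgue_measure R).
Implicit Types (a b M : R) (f : R -> R).

Lemma bounded_integrable_itvoc f a b M :
    measurable_fun `]a, b] f -> (forall x, x \in `]a, b] -> `|f x| <= M) ->
  mu.-integrable `]a, b] (EFin \o f).
Proof.
move=> mf fM; apply: measurable_bounded_integrable => //.
  suff : (mu `]a, b] < +oo)%E by [].
  by rewrite lebesgue_measure_itv/=; case: ifPn => // _; rewrite -EFinB ltry.
exists M; split; first exact: num_real.
by move=> N /ltW MN x /= xab; rewrite (le_trans (fM x xab)).
Qed.

Lemma Rintegral_cst_itvoc a b M : a <= b ->
  \int[mu]_(x in `]a, b]) M = M * (b - a).
Proof.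
move=> ab; rewrite Rintegral_cst//; congr (_ * _).
suff : mu `]a, b] = (b - a)%:E by move=> h; exact: (congr1 fine h).
rewrite lebesgue_measure_itv/= lte_fin.
case: ltgtP ab => [_ _| // |-> _]; first by rewrite -EFinB.
by rewrite subrr.
Qed.

Lemma ge0_subset_Rintegral f (A B : set R) :
    measurable A -> measurable B -> mu.-integrable B (EFin \o f) ->
    (forall x, B x -> 0 <= f x) -> A `<=` B ->
  \int[mu]_(x in A) f x <= \int[mu]_(x in B) f x.
Proof.
move=> mA mB fB f0 AB; apply: fine_le.
- apply: integrable_fin_num => //; exact: integrableS fB.
- exact: integrable_fin_num.
- apply: ge0_subset_integral => //; first exact: measurable_int fB.
Qed.

(** Dominated convergence with the constant majorant [M], integrable because the interval is
    bounded. *)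
Lemma Rintegral_bounded_cvg0 (f : nat -> R -> R) a b M :
    (forall n, measurable_fun `]a, b] (f n)) ->
    (forall n x, x \in `]a, b] -> 0 <= f n x <= M) ->
    {ae mu, forall x, x \in `]a, b] -> f n x @[n --> \oo] --> 0} ->
  \int[mu]_(x in `]a, b]) f n x @[n --> \oo] --> 0.
Proof.
move=> mf fM f0.
have iM : mu.-integrable `]a, b] (EFin \o cst M).
  exact: (@bounded_integrable_itvoc _ a b `|M|).
have mfE n : measurable_fun `]a, b] (EFin \o f n) by exact/measurable_EFinP.
have fE : {ae mu, forall x, `]a, b]%classic x ->
    (EFin \o f n) x @[n --> \oo] --> cst 0%E x}.
  apply: (@filterS _ _ (ae_filter_ringOfSetsType mu) _ _ _ f0) => x /= fx xab.
  by apply: cvg_EFin; [exact: nearW|exact: fx].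
have fME : {ae mu, forall x n, `]a, b]%classic x ->
    (`|(EFin \o f n) x| <= (EFin \o cst M) x)%E}.
  apply: aeW => x n xab; have /andP[f0' fMx] := fM n x xab.
  by rewrite gee0_abs lee_fin.
have m0 : measurable_fun `]a, b] (cst 0%E : R -> \bar R) by [].
have [_ _] := @dominated_convergence _ _ _ mu _ (measurable_itv _) _ _ _
  mfE m0 fE iM fME.
by rewrite integral0 => /fine_cvgP[].
Qed.

End bounded_integrals.

(** * Uniform convergence for slowly varying functions, additive form *)

(* If [d_x(t) = min(1, |k(tx) - k(x)|)] then [d_x(a) <= d_{ax}(t) + d_x(at)];
   averaging over [t] in (1, 2] bounds [d_x(a)], uniformly in [a], by integrals
   that tend to 0 by dominated convergence. *)
Lemma slowly_varying_uniform_additive (R : realType) (k : R -> R) (r : R) :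
    measurable_fun setT k ->
    (forall a : R, 0 < a -> k (a * x) - k x @[x --> +oo] --> 0) ->
    1 < r ->
  forall eps : R, 0 < eps ->
    \forall x \near +oo, forall a : R, 1 <= a <= r -> `|k (a * x) - k x| < eps.
Proof.
move=> mk hk r1 eps eps0.
(* The truncation at 1 supplies a constant majorant, so no local bound on [k] is required. *)
pose d x t := Num.min 1 `|k (t * x) - k x|.
have d0 x t : 0 <= d x t by rewrite le_min ler01 normr_ge0.
have d1 x t : d x t <= 1 by rewrite ge_min lexx.
have md x : measurable_fun setT (d x).
  apply: measurable_minr => //.
  apply: measurableT_comp => //; apply: measurable_funB => //.
  by apply: measurableT_comp => //; apply: mulrr_measurable.
have id x a b : (@lebesgue_measure R).-integrable `]a, b] (EFin \o d x).
  apply: (@bounded_integrable_itvoc _ _ _ _ 1); first exact: measurable_funTS.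
  by move=> t _; rewrite ger0_norm.
(* The range reaches [2 * r] because the substitution of [a * t] for [t] maps []1, 2]] onto []a, 2 *
   a]], which lies in []1, 2 * r]]. *)
pose G x := \int[lebesgue_measure]_(t in `]1, 2 * r]) d x t.
have G0 : G x @[x --> +oo] --> 0.
  (* Dominated convergence is about sequences, so the limit at [+oo] is tested along an arbitrary
     sequence [u]. *)
  apply/cvg_pinftyP => u uy; apply: (@Rintegral_bounded_cvg0 _ _ _ _ 1).
  - by move=> n; exact: measurable_funTS.
  - by move=> n x _; rewrite d0 d1.
  - apply: aeW => t /=; rewrite in_itv/= => /andP[t1 _].
    have : k (t * u n) - k (u n) @[n --> \oo] --> 0.
      have t0 : 0 < t by exact: lt_trans t1.
      exact: (cvg_comp u (fun x => k (t * x) - k x) uy (hk t t0)).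
    move=> /cvg_norm; rewrite normr0 => kt.
    apply: (@squeeze_cvgr _ _ _ _ (cst 0) (fun n => `|k (t * u n) - k (u n)|)) => //.
    + by apply: nearW => n; rewrite d0 ge_min lexx orbT.
    + exact: cvg_cst.
have dG (x a : R) : 0 < x -> 1 <= a <= r -> d x a <= G (a * x) + G x.
  move=> x0 /andP[a1 ar].
  have a0 : 0 < a by exact: lt_le_trans a1.
  (* Truncation at 1 preserves the triangle inequality; the intermediate value is [k] at
     [a * t * x]. *)
  have tri t : d x a <= d (a * x) t + d x (a * t).
    rewrite /d; have -> : a * t * x = t * (a * x) by ring.
    have := ler_distD (k (t * (a * x))) (k (a * x)) (k x).
    rewrite [`|k (a * x) - k (t * _)|]distrC.
    by rewrite /Num.min; do 3 case: ifPn; rewrite -?leNgt => *;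
      have := normr_ge0 (k (t * (a * x)) - k (a * x));
      have := normr_ge0 (k (t * (a * x)) - k x); lra.
  have ida : (@lebesgue_measure R).-integrable `]1, 2] (EFin \o (fun t => d x (a * t))).
    apply: (@bounded_integrable_itvoc _ _ _ _ 1).
      apply: measurable_funTS.
      by apply: measurableT_comp => //; exact: mulrl_measurable.
    by move=> t _; rewrite ger0_norm.
  have -> : d x a = \int[lebesgue_measure]_(t in `]1, 2]) d x a.
    rewrite Rintegral_cst_itvoc ?ler1n//.
    by ring.
  have h : \int[lebesgue_measure]_(t in `]1, 2]) d x a <=
      \int[lebesgue_measure]_(t in `]1, 2]) (d (a * x) t + d x (a * t)).
    apply: le_Rintegral => //.
      apply: (@bounded_integrable_itvoc _ _ _ _ 1) => //.
      by move=> t _; rewrite ger0_norm.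
    rewrite (_ : _ \o _ = (EFin \o d (a * x)) \+ (EFin \o (fun t => d x (a * t)))) //.
    by apply: integrableD => //.
  apply: (le_trans h); rewrite RintegralD//.
  apply: lerD.
    apply: ge0_subset_Rintegral => // t /=; rewrite !in_itv/=.
    by move=> /andP[-> t2]/=; rewrite (le_trans t2)// ler_peMr// ltW.
  have := @ge0_Rintegral_scale R a 1 2 (d x) a0.
  set I := (X in _ = a * X).
  rewrite mulr1 => /(_ (measurable_funTS (md x)) (fun t _ => d0 x t)) Ia.
  have I0 : 0 <= I by exact: Rintegral_ge0.
  (* Since [a] is at least 1, the Jacobian [a] can be inserted; [a * I] is then the integral over
     []a, 2 * a]]. *)
  rewrite (@le_trans _ _ (a * I))//; first by rewrite ler_peMl.
  rewrite -Ia; apply: ge0_subset_Rintegral => // t /=; rewrite !in_itv/=.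
  move=> /andP[ta t2]; rewrite (le_lt_trans a1 ta) (le_trans t2)//.
  by rewrite mulrC ler_pM2l.
(* A bound below 1 excludes the truncated value of [d], so that [d x a] is small only if the
   difference of [k] is. *)
have e0 : 0 < Num.min 1 eps / 2 by rewrite divr_gt0// lt_min ltr01.
move/cvgr0Pnorm_lt : G0 => /(_ _ e0)[T [_ GT]].
exists (Num.max T 0); split; first exact: num_real.
move=> x; rewrite gt_max => /andP[Tx x0] a a1r.
have ax : x <= a * x by rewrite ler_peMl ?(ltW x0)//; case/andP: a1r.
have := dG x a x0 a1r.
have := le_lt_trans (ler_norm _) (GT x Tx).
have := le_lt_trans (ler_norm _) (GT (a * x) (lt_le_trans Tx ax)).
move=> G1 G2 dGx.
have : d x a < Num.min 1 eps by move: (Num.min 1 eps) G1 G2 dGx => m; lra.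
rewrite lt_min /d !gt_min ltxx/= => /andP[h1 /orP[e1|//]].
exact: lt_trans e1.
Qed.

(** * Discontinuities of right-continuous functions *)

(* At each point of [D k], the set where the oscillation is at least [e k], right
   continuity provides an interval on the right that misses [D k]. *)
Lemma right_continuous_discontinuity_countable (R : realType) (p : R -> R) :
    (forall x, 0 < x -> p y @[y --> x^'+] --> p x) ->
  countable [set x | 0 < x /\ ~ {for x, continuous p}].
Proof.
move=> rcp.
pose e k : R := k.+1%:R^-1.
have e0 k : 0 < e k by rewrite invr_gt0.
pose D k := [set x | 0 < x /\
  forall d, 0 < d -> exists y, `|y - x| < d /\ e k <= `|p y - p x|].
apply: (@sub_countable _ _ _ (\bigcup_k D k)); last first.
  apply: bigcup_countable => // k _.
  have [d dP] : {d : R -> R & forall x, 0 < d x /\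
      (0 < x -> forall y, x < y -> y < x + d x -> `|p y - p x| < e k / 2)}.
    apply: (@boolp.choice _ _ (fun x dx => 0 < dx /\
      (0 < x -> forall y, x < y -> y < x + dx -> `|p y - p x| < e k / 2))).
    move=> x; have [x0|x0] := ltP 0 x; last by exists 1; rewrite ltr01.
    have /cvgrPdist_lt /(_ (e k / 2)) := rcp _ x0.
    rewrite divr_gt0// => /(_ isT); rewrite near_withinE.
    move=> /nbhs_ballP[dx /= dx0 H]; exists dx; split => // _ y xy yx.
    rewrite distrC; apply: H => //=.
    by rewrite /ball/= distrC gtr0_norm ?subr_gt0// ltrBlDl.
  apply: (@separated_open_countable R R (fun x => `]x, x + d x[%classic)).
  - by move=> x; exact: interval_open.
  - move=> x; exists (x + d x / 2); rewrite /= in_itv/=.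
    have [dx0 _] := dP x; apply/andP; split; lra.
  (* If the intervals of [x < y] met, [y] would lie in the interval of [x], and so would every [w]
     close to [y]. Then [p w] and [p y] are both within [e k / 2] of [p x], which contradicts
     [D k y]. *)
  suff H x y z : D k x -> D k y -> x < y ->
      z \in `]x, x + d x[ -> z \in `]y, y + d y[ -> False.
    move=> x y Dx Dy [z [/= zx zy]]; case: (ltgtP x y) => // xy; exfalso.
      exact: (H x y z).
    exact: (H y x z).
  move=> [x0 _] [_ Dy] xy; rewrite !in_itv/= => /andP[_ zx] /andP[yz _].
  have [dx0 /(_ x0) dxP] := dP x.
  have yxd : y < x + d x by exact: lt_trans zx.
  have /Dy[w [wy]] : 0 < Num.min (y - x) (x + d x - y).
    by rewrite lt_min !subr_gt0 xy.
  move: wy; rewrite lt_min !ltr_norml => /andP[/andP[w1 w2] /andP[w3 w4]].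
  apply/negP; rewrite -ltNge.
  have xw : x < w by lra.
  have wx : w < x + d x by lra.
  have := dxP y xy yxd; have := dxP w xw wx.
  rewrite !ltr_norml => /andP[? ?] /andP[? ?]; apply/andP; split; lra.
apply: subset_card_le => x [x0 cx]; apply: contrapT => nD; apply: cx.
apply/cvgrPdist_lt => eps eps0.
have [k ke] : exists k, e k < eps.
  exists (Num.truncn eps^-1); rewrite /e invf_plt ?posrE//.
  by rewrite truncnS_gt.
have {}nD : ~ D k x by move=> Dx; apply: nD; exists k.
apply: contrapT => nd; apply: nD; split => // d d0.
apply: contrapT => H; apply: nd; apply/nbhs_ballP; exists d => //= y xy.
rewrite ltNge; apply/negP => H1; apply: H; exists y; split.
  by rewrite distrC.
by rewrite distrC (le_trans (ltW ke)).
Qed.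

(** * Geometric blocks and contracting recursions *)

Lemma exprn_unbounded (R : realType) (r x : R) : 1 < r -> exists n, x < r ^+ n.
Proof.
move=> r1; have r0 : 0 < r by exact: lt_trans r1.
have [x0|x0] := leP x 0; first by exists 0%N; rewrite expr0 (le_lt_trans x0).
have : (r^-1) ^+ n @[n --> \oo] --> 0.
  by apply: cvg_expr; rewrite gtr0_norm ?invr_gt0// invf_lt1.
move=> /cvgr0Pnorm_lt /(_ x^-1); rewrite invr_gt0 => /(_ x0)[n _ /(_ n (leqnn n))].
rewrite /= gtr0_norm ?exprn_gt0 ?invr_gt0// exprVn ltf_pV2 ?posrE ?exprn_gt0//.
by exists n.
Qed.

(** Take the least [n] from [N] on with [x < r ^+ n.+1]: the lower bound is minimality if [n]
    exceeds [N], and the hypothesis if [n = N]. *)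
Lemma geometric_grid (R : realType) (r x : R) (N : nat) :
    1 < r -> r ^+ N <= x ->
  exists2 n, (N <= n)%N & r ^+ n <= x <= r ^+ n.+1.
Proof.
move=> r1 rNx.
have [n0 xr] := exprn_unbounded x r1.
have ex : exists n, (N <= n)%N && (x < r ^+ n.+1).
  exists (N + n0)%N; rewrite leq_addr/= (lt_le_trans xr)//.
  by rewrite ler_eXn2l// leqW// leq_addl.
case: (ex_minnP ex) => n /andP[Nn xn] nmin; exists n => //.
rewrite (ltW xn) andbT.
move: Nn; rewrite leq_eqVlt => /orP[/eqP<-//|].
case: n xn nmin => // n xn nmin Nn; rewrite leNgt; apply/negP => xrn.
by have := nmin n; rewrite -ltnS Nn xrn ltnn => /(_ isT).
Qed.

(** Dividing [x] by [r] repeatedly brings it to the first block, where [E] is bounded by [C]; each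
    division contributes a factor [c] and a small error, and the errors sum to a geometric
    series. *)
Lemma contraction_cvg0 (R : realType) (r c X : R) (a b E : R -> R) :
    1 < r -> 0 < X -> 0 <= c < 1 ->
    (forall T, X <= T -> exists C : R, forall x, T <= x <= r * T -> `|E x| <= C) ->
    (forall x, X <= x -> `|a x| <= c) ->
    b x @[x --> +oo] --> 0 ->
    (forall x, X <= x -> E x = a x * E (x / r) + b x) ->
  E x @[x --> +oo] --> 0.
Proof.
move=> r1 X0 /andP[c0 c1] Eb ac b0 rec; apply/cvgr0Pnorm_le => /= eps eps0.
have r0 : 0 < r by rewrite (lt_trans _ r1).
(* This tolerance makes [eps / 2] the fixed point of [t -> c * t + eps / 2 * (1 - c)], so the
   accumulated error never exceeds [eps / 2]. *)
have [T0 [_ bT]] : \forall x \near +oo, `|b x| <= eps / 2 * (1 - c).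
  have h : 0 < eps / 2 * (1 - c) by rewrite mulr_gt0 ?divr_gt0 ?subr_gt0.
  by move/cvgr0Pnorm_le : b0; exact.
pose T := Num.max X (T0 + 1).
have XT : X <= T by rewrite le_max lexx.
have T_gt0 : 0 < T by exact: lt_le_trans XT.
have {}bT x : T <= x -> `|b x| <= eps / 2 * (1 - c).
  by move=> Tx; apply: bT; rewrite (lt_le_trans _ Tx)// lt_max ltrDl ltr01 orbT.
have [C EC] := Eb T XT.
have C0 : 0 <= C.
  by apply: le_trans (EC T _) => //; rewrite lexx ler_peMl ?(ltW T_gt0) ?ltW.
have step n x : r ^+ n <= x / T <= r ^+ n.+1 -> `|E x| <= c ^+ n * C + eps / 2.
  elim: n x => [|n ih] x.
    rewrite expr0 expr1 mul1r ler_pdivlMr// mul1r ler_pdivrMr// => /EC.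
    by move=> /le_trans; apply; rewrite lerDl; lra.
  move=> /andP[x1 x2].
  have Tx : T <= x.
    by rewrite -[T]mul1r -ler_pdivlMr// (le_trans _ x1)// exprn_ege1// ltW.
  have /ih {}ih : r ^+ n <= x / r / T <= r ^+ n.+1.
    rewrite mulrAC ler_pdivlMr// ler_pdivrMr// -!exprSr.
    by rewrite x1 x2.
  rewrite rec ?(le_trans XT)// (le_trans (ler_normD _ _))// normrM exprS.
  have := ler_pM (normr_ge0 _) (normr_ge0 _) (ac x (le_trans XT Tx)) ih.
  have := bT x Tx.
  move: (c ^+ n) (`|a x| * _) (`|b x|) => *; lra.
have [N _ cN] : \forall n \near \oo, c ^+ n * C <= eps / 2.
  have /cvgr0Pnorm_le cC : c ^+ n * C @[n --> \oo] --> 0.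
    rewrite -[0](mul0r C); apply: cvgM; last exact: cvg_cst.
    by apply: cvg_expr; rewrite ger0_norm.
  have := cC (eps / 2); rewrite divr_gt0// => /(_ isT).
  apply: filterS => n; apply: le_trans; exact: ler_norm.
exists (r ^+ N * T); split; first exact: num_real.
move=> x; move=> /ltW; rewrite -ler_pdivlMr// => /(geometric_grid r1)[n Nn].
move=> /step /le_trans; apply.
by have /= := cN n Nn; move: (_ * C) => *; lra.
Qed.

(** * Uniform convergence, multiplicative form *)

(** The additive form is applied to the logarithm of [l]; continuity of [expR] at 0 turns small
    differences back into ratios close to 1. *)
Lemma slowly_varying_uniform (R : realType) (l : R -> R) (r : R) :
    slowly_varying l -> 1 < r ->
  forall eps : R, 0 < eps ->
    \forall x \near +oo, forall y, x / r <= y <= x -> `|l y / l x - 1| <= eps.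
Proof.
move=> [ml l0 hl] r1 eps eps0.
have r0 : 0 < r by exact: lt_trans r1.
(* The restriction extends the logarithm by a constant off the positive half-line, as the additive
   form asks for measurability on all of [R]. *)
pose k := (@ln R \o l) \_ `]0, +oo[.
have kE x : 0 < x -> k x = ln (l x).
  by move=> x0; rewrite /k patchT// inE/= in_itv/= x0.
have mk : measurable_fun setT k.
  by apply/(measurable_restrictT _ _).1 => //; exact: measurableT_comp.
have hk a : 0 < a -> k (a * x) - k x @[x --> +oo] --> 0.
  move=> a0; rewrite -(@ln1 R).
  have : ln (l (a * x) / l x) @[x --> +oo] --> ln (1 : R).
    by apply: continuous_cvg; [exact: continuous_ln|exact: hl].
  apply: cvg_trans; apply: near_eq_cvg; near=> x.
  have x0 : 0 < x by near: x; exact: nbhs_pinfty_gt.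
  have ax0 : 0 < a * x by rewrite mulr_gt0.
  by rewrite !kE// ln_div// posrE l0.
have [e /= e0 he] : exists2 e : R, 0 < e &
    forall s, `|s| < e -> `|expR s - 1| <= eps.
  have : expR x @[x --> (0 : R)] --> expR (0 : R) by exact: continuous_expR.
  rewrite expR0 => /cvgrPdist_le/(_ _ eps0).
  move=> /nbhs_ballP[e /= e0 he]; exists e => // s se.
  by rewrite distrC; apply: he; rewrite /ball/= sub0r normrN.
have [T [_ hT]] := slowly_varying_uniform_additive mk hk r1 e0.
(* The additive bound is used at the base point [y] with the factor [x / y] in [[1, r]]; the
   threshold carries a factor [r] so that [y], at least [x / r], is itself large. *)
exists (r * Num.max T 0); split; first exact: num_real.
move=> x; rewrite mulrC -ltr_pdivlMr// => xr y /andP[xy yx].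
have := lt_le_trans xr xy; rewrite gt_max => /andP[Ty y0].
have x0 : 0 < x by exact: lt_le_trans yx.
have := hT y Ty (x / y).
rewrite ler_pdivlMr// mul1r yx ler_pdivrMr// -ler_pdivrMl// mulrC xy => /(_ isT).
rewrite divfK ?gt_eqF// !kE// distrC => /he.
by rewrite -ln_div ?posrE ?l0// lnK// posrE divr_gt0// l0.
Unshelve. all: by end_near. Qed.

(** * Measurability and periodicity *)

(** Off its countable set of discontinuities the function is continuous, and on a countable set
    every function is measurable. *)
Lemma right_continuous_measurable (R : realType) (p : R -> R) :
    (forall x, 0 < x -> p y @[y --> x^'+] --> p x) ->
  measurable_fun (`]0, +oo[ : set R) p.
Proof.
move=> rcp.
pose D := [set x : R | 0 < x /\ ~ {for x, continuous p}].
have cD : countable D by exact: right_continuous_discontinuity_countable.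
have mD : measurable D.
  by apply: countable_measurable => // x; exact: measurable_set1.
have -> : (`]0, +oo[ : set R)%classic = (`]0, +oo[ `\` D) `|` D.
  rewrite setUC setDUK// => x [x0 _].
  by rewrite /= in_itv/= x0.
apply/measurable_funU => //; first exact: measurableD.
split.
  apply: subspace_continuous_measurable_fun; first exact: measurableD.
  apply: continuous_in_subspaceT => x; rewrite inE => -[/= + nD].
  rewrite in_itv/= andbT => x0.
  by apply: contrapT => cx; apply: nD.
move=> _ Y mY; apply: countable_measurable; first exact: measurable_set1.
exact: sub_countable (subset_card_le (@subIsetl _ _ _)) cD.
Qed.

Lemma periodic_exprn (R : realType) (r : R) (p : R -> R) n x : 1 < r ->
  (forall x, 0 < x -> p (x * r) = p x) -> 0 < x -> p (r ^+ n * x) = p x.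
Proof.
move=> r1 pr x0; have r0 : 0 < r by exact: lt_trans r1.
elim: n => [|n ih]; first by rewrite mul1r.
by rewrite exprSr mulrAC pr// mulr_gt0// exprn_gt0.
Qed.

(** * Means over one period block *)

(** If [x] lies between [r ^+ n] and [r ^+ n.+1], then []x / r, x]] is inside the dilate of []r^-1,
    r]] by [r ^+ n], and the resulting factor [r ^+ n / x] is at most 1. *)
Lemma block_mean_cvg0 (R : realType) (r M X : R) (f p : R -> R) :
    1 < r ->
    measurable_fun (`]0, +oo[ : set R) f -> measurable_fun (`]0, +oo[ : set R) p ->
    (forall x, X <= x -> `|f x| <= M) -> (forall x, 0 < x -> `|p x| <= M) ->
    (forall x, 0 < x -> p (x * r) = p x) ->
    {ae @lebesgue_measure R,
      forall z, 0 < z -> f (r ^+ n * z) @[n --> \oo] --> p z} ->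
  x^-1 * (\int[lebesgue_measure]_(y in `]x / r, x]) `|f y - p y|)
    @[x --> +oo] --> 0.
Proof.
move=> r1 mf mp fM pM pr fp.
have r0 : 0 < r by exact: lt_trans r1.
have [N NX] : exists N, X <= r ^+ N / r.
  have [n rXn] := exprn_unbounded (r * X) r1; exists n.
  by rewrite ler_pdivlMr// mulrC ltW.
pose h y := `|f y - p y|.
have mh : measurable_fun (`]0, +oo[ : set R) h.
  by apply: measurableT_comp => //; exact: measurable_funB.
have hM y : 0 < y -> X <= y -> `|h y| <= M + M.
  move=> y0 Xy; rewrite normr_id (le_trans (ler_normB _ _))//.
  by rewrite lerD ?fM ?pM.
have big n s : (N <= n)%N -> s \in `]r^-1, r] -> 0 < r ^+ n * s /\ X <= r ^+ n * s.
  move=> Nn; rewrite in_itv/= => /andP[rs _]; split.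
    by rewrite mulr_gt0 ?exprn_gt0// (lt_trans _ rs)// invr_gt0.
  rewrite (le_trans NX)// ler_pM ?exprn_ge0 ?invr_ge0 ?(ltW r0)//; last exact: ltW.
  by rewrite ler_weXn2l// ltW.
(* Starting at the exponent [N] keeps every argument beyond [X], so the majorant [M + M] holds for
   all [m] and not just eventually. *)
pose I m := \int[lebesgue_measure]_(s in `]r^-1, r]) h (r ^+ (N + m) * s).
have I0 : I m @[m --> \oo] --> 0.
  apply: (@Rintegral_bounded_cvg0 _ _ _ _ (M + M)).
  - move=> m; apply: (@measurable_comp _ _ _ _ _ _ (`]0, +oo[ : set R) h _
      ( *%R (r ^+ (N + m)))) => //.
    by move=> _ [s /(big _ _ (leq_addr m N))[s0 _] <-]; rewrite /= in_itv/= s0.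
  - move=> m s /(big _ _ (leq_addr m N))[s0 sX]; rewrite normr_ge0/=.
    by rewrite -[leLHS]normr_id hM.
  - apply: (@filterS _ _ (ae_filter_ringOfSetsType _) _ _ _ fp) => s /= fps.
    rewrite in_itv/= => /andP[rs _].
    have s0 : 0 < s by rewrite (lt_trans _ rs)// invr_gt0.
    have := fps s0; rewrite -(cvg_shiftn N) => fpN.
    rewrite (_ : (fun m => _) = fun m => `|f (r ^+ (m + N) * s) - p s|); last first.
      by apply/funext => m; rewrite /h (@periodic_exprn _ r p)// addnC.
    have := cvg_norm (cvgB fpN (cvg_cst (p s))); rewrite subrr normr0; exact.
apply/cvgr0Pnorm_le => e e0.
move/cvgr0Pnorm_le : I0 => /(_ _ e0)[m0 _ Ie].
exists (r ^+ (N + m0)); split; first exact: num_real.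
move=> x /ltW /(geometric_grid r1)[n Nn /andP[nx xn]].
have {}Nn : (N + m0 <= n)%N by [].
have Nn' : (N <= n)%N by exact: leq_trans (leq_addr _ _) Nn.
have rn0 : 0 < r ^+ n by exact: exprn_gt0.
have x0 : 0 < x by exact: lt_le_trans nx.
have := Ie (n - N)%N; rewrite /= leq_subRL// => /(_ Nn).
apply: le_trans.
rewrite /I subnKC//.
have blk y : y \in `](r ^+ n * r^-1), (r ^+ n * r)] -> 0 < y /\ X <= y.
  rewrite in_itv/= => /andP[y1 y2].
  have := @big n ((r ^+ n)^-1 * y) Nn'; rewrite mulVKf ?gt_eqF//; apply.
  by rewrite in_itv/= ltr_pdivlMl// ler_pdivrMl// y1.
have mhb : measurable_fun `](r ^+ n * r^-1), (r ^+ n * r)] h.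
  apply: measurable_funS mh => //.
  by move=> y /blk[y0 _]; rewrite /= in_itv/= y0.
rewrite !ger0_norm ?mulr_ge0 ?invr_ge0 ?(ltW x0) ?Rintegral_ge0//.
rewrite ler_pdivrMl//.
apply: (@le_trans _ _ (\int[lebesgue_measure]_(y in `](r ^+ n * r^-1), (r ^+ n * r)]) h y)).
  apply: ge0_subset_Rintegral => //.
    apply: (@bounded_integrable_itvoc _ _ _ _ (M + M)) => //.
    by move=> y /blk[y0 yX]; exact: hM.
  move=> y; rewrite /= !in_itv/= => /andP[xy yx]; apply/andP; split.
    by rewrite (le_lt_trans _ xy)// ler_pM2r// invr_gt0.
  by rewrite (le_trans yx)// -exprSr.
rewrite ge0_Rintegral_scale//; last by move=> *; exact: normr_ge0.
  by rewrite ler_wpM2r// Rintegral_ge0// => s _; exact: normr_ge0.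
by move=> s _; exact: normr_ge0.
Qed.

(** After taking logarithms this is [|a * (ln x - ln y)| <= |a| * ln r]. The absolute value serves
    both signs of the exponent, which will be [rho - 1]. *)
Lemma powR_block (R : realType) (r a x y : R) :
    1 < r -> 0 < x -> x / r <= y <= x ->
  (r `^ `|a|)^-1 * x `^ a <= y `^ a <= r `^ `|a| * x `^ a.
Proof.
move=> r1 x0 /andP[xy yx].
have r0 : 0 < r by exact: lt_trans r1.
have y0 : 0 < y by rewrite (lt_le_trans _ xy)// divr_gt0.
rewrite -powRN /powR !gt_eqF// -!expRD !ler_expR mulNr.
have lyx : ln y <= ln x by rewrite ler_ln ?posrE.
have lxy : ln x - ln r <= ln y by rewrite -ln_div ?posrE// ler_ln ?posrE ?divr_gt0.
have : `|a * (ln x - ln y)| <= `|a| * ln r.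
  by rewrite normrM ler_wpM2l// ger0_norm ?subr_ge0//; lra.
by rewrite ler_norml mulrBr => /andP[? ?]; apply/andP; split; lra.
Qed.

(** * Integrability of self-similar functions near 0 *)

Section self_similar_integrals.
Context {R : realType}.
Local Notation mu := (@lebesgue_measure R).

(** Each block further towards 0 carries [theta] times the integral of the previous one, so the
    total is dominated by a convergent geometric series. *)
Lemma self_similar_integrable (r theta x : R) (h : R -> R) :
    1 < r -> 0 <= theta < 1 -> 0 < x ->
    measurable_fun (`]0, +oo[ : set R) h -> (forall y : R, 0 < y -> 0 <= h y) ->
    (forall y : R, 0 < y -> h (r^-1 * y) = r * theta * h y) ->
    mu.-integrable `]x / r, x] (EFin \o h) ->
  mu.-integrable `]0, x] (EFin \o h).
Proof.
move=> r1 /andP[t0 t1] x0 mh h0 hr ih.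
have r0 : 0 < r by exact: lt_trans r1.
have mhE (a b : R) : 0 <= a -> measurable_fun `]a, b] (EFin \o h).
  move=> a0; apply/measurable_EFinP; apply: measurable_funS mh => //.
  by move=> y /=; rewrite !in_itv/= => /andP[/(le_lt_trans a0)->].
pose F n := `]x / r ^+ n, x]%classic.
have F0 n : 0 < x / r ^+ n by rewrite divr_gt0// exprn_gt0.
have h0E n y : F n y -> (0 <= (EFin \o h) y)%E.
  by rewrite /F/= in_itv/= lee_fin => /andP[/(lt_trans (F0 n)) y0 _]; exact: h0.
pose Q := \int[mu]_(y in `]x / r, x]) h y.
have QE : (\int[mu]_(y in `](x / r)%R, x]) (h y)%:E = Q%:E)%E.
  by rewrite /Q /Rintegral fineK//; exact: integrable_fin_num.
have Q0 : 0 <= Q.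
  apply: Rintegral_ge0 => y /=; rewrite in_itv/= => /andP[xy _].
  by apply: h0; apply: lt_trans xy; rewrite divr_gt0.
(* The bound is the fixed point of [t -> theta * t + Q]: [F n.+1] is the top block together with the
   dilate of [F n] by [r^-1]. *)
have bnd n : (\int[mu]_(y in F n) (EFin \o h) y <= (Q / (1 - theta))%:E)%E.
  elim: n => [|n ihn].
    rewrite /F expr0 divr1 set_itvoc0 integral_set0 lee_fin.
    by rewrite divr_ge0// subr_ge0 ltW.
  have xrn : x / r ^+ n.+1 <= x / r.
    rewrite ler_pM2l// lef_pV2 ?posrE ?exprn_gt0// -[leLHS]expr1.
    by rewrite ler_weXn2l// ltW.
  have xr : x / r <= x by rewrite ler_pdivrMr// ler_peMr// ltW.
  have FS : F n.+1 = `]x / r ^+ n.+1, x / r]%classic `|` `]x / r, x]%classic.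
    by rewrite /F (@itv_bndbnd_setU _ _ _ (BRight (x / r))).
  have mFS : measurable_fun (F n.+1) (EFin \o h).
    by apply: mhE; exact: ltW.
  have hFS := @h0E n.+1; move: mFS hFS; rewrite FS => mFS hFS.
  rewrite ge0_integral_setU//=; last first.
    apply/disj_setPS => y [/=]; rewrite !in_itv/= => /andP[_ yx] /andP[].
    by rewrite ltNge yx.
  rewrite QE.
  have -> : x / r ^+ n.+1 = r^-1 * (x / r ^+ n).
    by rewrite exprS invfM; ring.
  have -> : x / r = r^-1 * x by rewrite mulrC.
  have ri0 : 0 < r^-1 by rewrite invr_gt0.
  rewrite ge0_integral_scale//; last 2 first.
  - by apply: mhE; rewrite mulr_ge0 ?ltW.
  - move=> y; rewrite in_itv/= lee_fin => /andP[y0 _]; apply: h0.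
    by apply: lt_trans y0; rewrite mulr_gt0.
  have -> : (\int[mu]_(y in `](x / r ^+ n)%R, x]) (h (r^-1 * y)%R)%:E =
      (r * theta)%:E * \int[mu]_(y in F n) (EFin \o h) y)%E.
    rewrite -ge0_integralZl_EFin//=.
    - apply: eq_integral => y; rewrite inE/= in_itv/= => /andP[y0 _].
      by rewrite -EFinM hr// (lt_trans _ y0).
    - exact: measurable_itv.
    - by move=> y; exact: (h0E n).
    - by apply: mhE; exact: ltW.
    - by rewrite mulr_ge0// ltW.
  rewrite muleA -EFinM mulrA mulVf ?gt_eqF// mul1r.
  have -> : Q / (1 - theta) = theta * (Q / (1 - theta)) + Q.
    by field; rewrite subr_eq0 gt_eqF.
  rewrite EFinD leeD2r// EFinM lee_wpmul2l// lee_fin.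
have UF : `]0, x]%classic = \bigcup_n F n.
  apply/seteqP; split => y.
    rewrite /= in_itv/= => /andP[y0 yx].
    have [n xyn] := exprn_unbounded (x / y) r1.
    exists n => //; rewrite /F/= in_itv/= yx andbT.
    by rewrite ltr_pdivrMr ?exprn_gt0// mulrC -ltr_pdivrMr.
  by move=> [n _]; rewrite /F/= !in_itv/= => /andP[/(lt_trans (F0 n))->].
apply/integrableP; split; first exact: mhE.
rewrite [ltLHS](_ : _ = \int[mu]_(y in `]0%R, x]) (EFin \o h) y)%E; last first.
  apply: eq_integral => y; rewrite inE/= in_itv/= => /andP[y0 _].
  by rewrite ger0_norm// h0.
(* Monotone convergence along the increasing sets [F n] carries the uniform bound to []0, x]]. *)
have := @ge0_nondecreasing_set_cvg_integral _ (measurableTypeR R) _ F (EFin \o h) mu.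
rewrite -UF => cv.
apply: (@le_lt_trans _ _ (Q / (1 - theta))%:E); last exact: ltry.
apply: (cvge_le _ (cv _ _ _ _)).
- by apply: nearW => n; exact: bnd.
- move=> m n mn; apply/subsetPset => y; rewrite /F/= !in_itv/= => /andP[y1 ->].
  rewrite andbT (le_lt_trans _ y1)// ler_pM2l// lef_pV2 ?posrE ?exprn_gt0//.
  by rewrite ler_weXn2l// ltW.
- by move=> n; exact: measurable_itv.
- by move=> n; apply: mhE; exact: ltW.
- by move=> n y; exact: h0E.
Qed.

End self_similar_integrals.

(** * The operator [B_op] on periodic functions *)

Lemma periodicP_bounds (R : realType) (r : R) (p : R -> R) :
    1 < r -> periodicP r p ->
  exists m M, 0 < m /\ forall x, 0 < x -> m <= p x <= M.
Proof.
move=> r1 [p0 pb _ infp pr].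
have r0 : 0 < r by exact: lt_trans r1.
have [M [_ pM]] := pb.
exists (inf (p @` `[1, r])), (M + 1); split => // x x0; apply/andP; split; last first.
  by rewrite (le_trans (ler_norm _))// pM ?ltrDl//= in_itv/= x0.
(* As [x] may be less than 1, it is first multiplied by [r ^+ k] to reach at least 1, then divided
   by a power of [r] to land in [[1, r]], where the infimum is taken. *)
have [k xk] := exprn_unbounded x^-1 r1.
have : 1 <= r ^+ k * x.
  by rewrite -ler_pdivrMr// mul1r ltW.
move=> /(geometric_grid (N := 0) r1)[n _ /andP[nx xn]].
have rn0 : 0 < r ^+ n by rewrite exprn_gt0.
apply: ge_inf.
  exists 0 => _ [y /= + <-]; rewrite in_itv/= => /andP[y1 _].
  by rewrite ltW// p0// (lt_le_trans _ y1).
exists (r ^+ k * x / r ^+ n).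
  by rewrite /= in_itv/= ler_pdivlMr// mul1r nx ler_pdivrMr// -exprS.
rewrite -(@periodic_exprn _ r p n)//; last by rewrite divr_gt0// (lt_le_trans _ nx).
by rewrite mulrCA divff ?gt_eqF// mulr1 (@periodic_exprn _ r p).
Qed.

Section B_operator.
Context {R : realType}.
Local Notation mu := (@lebesgue_measure R).
Implicit Types (r rho m M x : R) (p : R -> R).

Lemma weight_scale r rho p (y : R) : 1 < r -> 0 < y ->
    (forall x, 0 < x -> p (x * r) = p x) ->
  (r^-1 * y) `^ (rho - 1) * p (r^-1 * y) =
  r * r `^ (- rho) * (y `^ (rho - 1) * p y).
Proof.
move=> r1 y0 pr; have r0 : 0 < r by exact: lt_trans r1.
have -> : p (r^-1 * y) = p y.
  by rewrite -(pr (r^-1 * y)) ?mulr_gt0 ?invr_gt0// mulrAC mulVf ?gt_eqF// mul1r.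
rewrite powRM ?invr_ge0 ?(ltW r0) ?(ltW y0)// mulrA -[in LHS]powR_inv1 ?(ltW r0)//.
rewrite -powRrM -[X in X * r `^ _]powRr1 ?(ltW r0)// -powRD; last first.
  by apply/implyP => _; rewrite gt_eqF.
by rewrite [-1 * _](_ : _ = 1 + - rho) ?mulrA//; ring.
Qed.

Lemma measurable_weight rho p : measurable_fun (`]0, +oo[ : set R) p ->
  measurable_fun (`]0, +oo[ : set R) (fun y : R => y `^ (rho - 1) * p y).
Proof.
by move=> mp; apply: measurable_funM => //; exact: measurable_funTS (measurable_powR _).
Qed.

Lemma weight_integrable_block r rho M p x : 1 < r -> 0 < x ->
    measurable_fun (`]0, +oo[ : set R) p ->
    (forall x, 0 < x -> 0 <= p x <= M) ->
  mu.-integrable `]x / r, x] (EFin \o fun y : R => y `^ (rho - 1) * p y).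
Proof.
move=> r1 x0 mp pM; have r0 : 0 < r by exact: lt_trans r1.
have xr0 : 0 < x / r by exact: divr_gt0.
apply: (@bounded_integrable_itvoc _ _ _ _ (r `^ `|rho - 1| * x `^ (rho - 1) * M)).
  apply: measurable_funS (measurable_weight rho mp) => //.
  by move=> y /=; rewrite !in_itv/= => /andP[/(lt_trans xr0)->].
move=> y; rewrite in_itv/= => /andP[xy yx].
have y0 := lt_trans xr0 xy; have /andP[p0 py] := pM y y0.
rewrite ger0_norm ?mulr_ge0 ?powR_ge0// ler_pM ?powR_ge0//.
by have := @powR_block _ r (rho - 1) x y r1 x0; rewrite (ltW xy) yx => /(_ isT)/andP[].
Qed.

Lemma weight_integrable r rho M p x : 1 < r -> 0 < rho -> 0 < x ->
    measurable_fun (`]0, +oo[ : set R) p ->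
    (forall x, 0 < x -> 0 <= p x <= M) ->
    (forall x, 0 < x -> p (x * r) = p x) ->
  mu.-integrable `]0, x] (EFin \o fun y : R => y `^ (rho - 1) * p y).
Proof.
move=> r1 rho0 x0 mp pM pr; have r0 : 0 < r by exact: lt_trans r1.
apply: (@self_similar_integrable _ r (r `^ (- rho))) => //.
- rewrite powR_ge0 powRN invf_lt1 ?powR_gt0//.
  by rewrite /powR gt_eqF// -expR0 ltr_expR mulr_gt0// ln_gt0.
- exact: measurable_weight.
- by move=> y /pM/andP[py _]; rewrite mulr_ge0 ?powR_ge0.
- by move=> y y0; exact: weight_scale.
- exact: weight_integrable_block pM.
Qed.

Lemma Rintegral_itvoc_split (f : R -> R) r x : 1 < r -> 0 < x ->
    mu.-integrable `]0, x] (EFin \o f) ->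
  \int[mu]_(y in `]0, x]) f y =
  \int[mu]_(y in `]0, x / r]) f y + \int[mu]_(y in `]x / r, x]) f y.
Proof.
move=> r1 x0 fi; have r0 : 0 < r by exact: lt_trans r1.
have := @Rintegral_itvB _ f (BRight 0) (BRight x) (x / r) fi.
rewrite !bnd_simp divr_ge0 ?(ltW x0) ?(ltW r0)// => /(_ isT) <-; first by ring.
by rewrite ler_pdivrMr// ler_peMr// ltW.
Qed.

(** Dilation by [r^-1] yields the factor [r^-1], the weight yields [r * r]^ (-
    rho)[, and the prefactor yields]r [^ rho]; their product is 1. *)
Lemma B_op_scale r rho M p x : 1 < r -> 0 < rho -> 0 < x ->
    measurable_fun (`]0, +oo[ : set R) p ->
    (forall x, 0 < x -> 0 <= p x <= M) ->
    (forall x, 0 < x -> p (x * r) = p x) ->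
  B_op rho p (x / r) = B_op rho p x.
Proof.
move=> r1 rho0 x0 mp pM pr; have r0 : 0 < r by exact: lt_trans r1.
have ri0 : 0 < r^-1 by rewrite invr_gt0.
rewrite /B_op [x / r]mulrC.
have := @ge0_Rintegral_scale _ r^-1 0 x (fun y => y `^ (rho - 1) * p y) ri0.
rewrite mulr0 => ->; last 2 first.
- apply: measurable_funS (measurable_weight rho mp) => //.
  by move=> y /=; rewrite !in_itv/= => /andP[->].
- by move=> y; rewrite in_itv/= => /andP[/pM/andP[py _] _]; rewrite mulr_ge0 ?powR_ge0.
rewrite [X in _ * (r^-1 * X)](_ : _ =
    r * r `^ (- rho) * \int[mu]_(y in `]0, x]) (y `^ (rho - 1) * p y)); last first.
  rewrite -RintegralZl//; last exact: weight_integrable pM pr.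
  apply: eq_Rintegral => y; rewrite inE/= in_itv/= => /andP[y0 _].
  exact: weight_scale.
rewrite powRM ?invr_ge0 ?(ltW r0) ?(ltW x0)//.
have -> : r^-1 `^ (- rho) = (r `^ (- rho))^-1.
  by rewrite -[in LHS]powR_inv1 ?(ltW r0)// -powRrM mulN1r !powRN.
have : r `^ (- rho) != 0 by rewrite gt_eqF// powR_gt0.
move: (r `^ _) (x `^ _) (\int[_]_(_ in _) _) => th xr I th0.
by field; rewrite th0 gt_eqF.
Qed.

Lemma B_op_recursion r rho M p x : 1 < r -> 0 < rho -> 0 < x ->
    measurable_fun (`]0, +oo[ : set R) p ->
    (forall x, 0 < x -> 0 <= p x <= M) ->
    (forall x, 0 < x -> p (x * r) = p x) ->
  B_op rho p x = r `^ (- rho) * B_op rho p x +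
    x `^ (- rho) * \int[mu]_(y in `]x / r, x]) (y `^ (rho - 1) * p y).
Proof.
move=> r1 rho0 x0 mp pM pr; have r0 : 0 < r by exact: lt_trans r1.
rewrite -[in X in _ = X + _](@B_op_scale r rho M p x)//.
rewrite [in LHS]/B_op (Rintegral_itvoc_split r1 x0); last exact: weight_integrable pM pr.
rewrite mulrDr /B_op [X in _ = X + _]mulrA -powRM ?divr_ge0 ?(ltW r0) ?(ltW x0)//.
by rewrite [r * _]mulrC divfK ?gt_eqF.
Qed.

(** Write the recursion as [B = th * B + Q]. Dropping [th * B] gives the lower bound and solving for
    [B] the upper one. The positive lower bound later allows division by [B]. *)
Lemma B_op_bounds r rho m M p : 1 < r -> 0 < rho -> 0 < m ->
    measurable_fun (`]0, +oo[ : set R) p ->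
    (forall x, 0 < x -> m <= p x <= M) ->
    (forall x, 0 < x -> p (x * r) = p x) ->
  exists c C, 0 < c /\ forall x, 0 < x -> c <= B_op rho p x <= C.
Proof.
move=> r1 rho0 m0 mp pmM pr; have r0 : 0 < r by exact: lt_trans r1.
have pM x : 0 < x -> 0 <= p x <= M.
  by move=> /pmM/andP[mp' ->]; rewrite (le_trans (ltW m0) mp').
have M0 : 0 <= M by have /andP[] := pM 1 ltr01; exact: le_trans.
pose K := r `^ `|rho - 1|.
have K0 : 0 < K by exact: powR_gt0.
pose th := r `^ (- rho).
have th0 : 0 < th by exact: powR_gt0.
have th1 : th < 1.
  rewrite /th powRN invf_lt1 ?powR_gt0//.
  by rewrite /powR gt_eqF// -expR0 ltr_expR mulr_gt0// ln_gt0.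
have ri1 : r^-1 < 1 by rewrite invf_lt1.
exists (K^-1 * m * (1 - r^-1)), (K * M * (1 - r^-1) / (1 - th)); split.
  by rewrite !mulr_gt0 ?invr_gt0// subr_gt0.
move=> x x0; have := @B_op_recursion r rho M p x r1 rho0 x0 mp pM pr.
set Q := _ * \int[mu]_(y in _) _ => BQ.
have xr0 : 0 < x / r by exact: divr_gt0.
have xrx : x / r <= x by rewrite ler_pdivrMr// ler_peMr// ltW.
have hb y : y \in `]x / r, x] ->
    K^-1 * x `^ (rho - 1) * m <= y `^ (rho - 1) * p y <= K * x `^ (rho - 1) * M.
  rewrite in_itv/= => /andP[xy yx].
  have := @powR_block _ r (rho - 1) x y r1 x0; rewrite (ltW xy) yx => /(_ isT)/andP[k1 k2].
  have y0 := lt_trans xr0 xy.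
  have /andP[p0 _] := pM y y0; have /andP[mpy pyM] := pmM y y0.
  by rewrite !ler_pM ?mulr_ge0 ?powR_ge0 ?invr_ge0 ?(ltW K0) ?(ltW m0).
have ih := @weight_integrable_block r rho M p x r1 x0 mp pM.
have ic (c : R) : mu.-integrable `]x / r, x] (EFin \o cst c).
  exact: (@bounded_integrable_itvoc _ _ _ _ `|c|).
(* The powers of [x] from the prefactor, the weight and the block length cancel, which makes the
   bounds on [Q] independent of [x]. *)
have xp : x `^ (- rho) * (x `^ (rho - 1) * x) = 1.
  rewrite [_ * x]mulrC mulr_powRB1 ?(ltW x0)// powRN mulVf//.
  by rewrite gt_eqF// powR_gt0.
have Q1 : K^-1 * m * (1 - r^-1) <= Q.
  have := @le_Rintegral _ _ _ mu `]x / r, x] _ _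
    (measurable_itv _) (ic (K^-1 * x `^ (rho - 1) * m)) ih.
  move=> /(_ (fun y hy => proj1 (andP (hb y hy)))).
  rewrite Rintegral_cst_itvoc// => /(ler_wpM2l (powR_ge0 x (- rho))); apply: le_trans.
  rewrite [leRHS](_ : _ = x `^ (- rho) * (x `^ (rho - 1) * x) * (K^-1 * m * (1 - r^-1))).
    by rewrite xp mul1r.
  by ring.
have Q2 : Q <= K * M * (1 - r^-1).
  have := @le_Rintegral _ _ _ mu `]x / r, x] _ _
    (measurable_itv _) ih (ic (K * x `^ (rho - 1) * M)).
  move=> /(_ (fun y hy => proj2 (andP (hb y hy)))).
  rewrite Rintegral_cst_itvoc// => /(ler_wpM2l (powR_ge0 x (- rho))) /le_trans; apply.
  rewrite [leLHS](_ : _ = x `^ (- rho) * (x `^ (rho - 1) * x) * (K * M * (1 - r^-1))).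
    by rewrite xp mul1r.
  by ring.
have B0 : 0 <= B_op rho p x.
  rewrite mulr_ge0 ?powR_ge0// Rintegral_ge0// => y /=; rewrite in_itv/= => /andP[/pM/andP[py _] _].
  by rewrite mulr_ge0 ?powR_ge0.
rewrite -/th in BQ.
apply/andP; split; first by rewrite (le_trans Q1)// BQ lerDr mulr_ge0// ltW.
by rewrite ler_pdivlMr ?subr_gt0//; lra.
Qed.

End B_operator.

(** * Eventual bounds, integrability and measurability *)

Lemma limf_esup_pinfty_bounded (R : realType) (f : R -> R) :
    (limf_esup (fun x => (f x)%:E) (+oo%R : set_system R) < +oo)%E ->
  exists M X : R, forall x, X <= x -> f x <= M.
Proof.
rewrite limf_esupE => /ereal_inf_lt[_ [A [X [_ XA]] <-]] sA.
exists (fine (ereal_sup [set (f x)%:E | x in A])), (X + 1) => x Xx.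
have fA : ((f x)%:E <= ereal_sup [set (f x)%:E | x in A])%E.
  apply: ereal_sup_ubound; exists x => //; apply: XA.
  by rewrite (lt_le_trans _ Xx)// ltrDl.
(* The supremum is a real number: [sA] excludes [+oo], and the value [f x] below it excludes
   [-oo]. *)
by move: sA fA; case: ereal_sup => // s; rewrite lee_fin.
Qed.

Section real_integrable.
Context {R : realType}.
Local Notation mu := (@lebesgue_measure R).
Implicit Types (A : set R) (f g : R -> R).

Lemma real_integrableZl A (c : R) f : measurable A ->
  mu.-integrable A (EFin \o f) -> mu.-integrable A (EFin \o (fun x => c * f x)).
Proof. by move=> mA; exact: (@integrableZl _ _ R mu A mA c (EFin \o f)). Qed.

Lemma real_integrableD A f g : measurable A ->
  mu.-integrable A (EFin \o f) -> mu.-integrable A (EFin \o g) ->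
  mu.-integrable A (EFin \o (fun x => f x + g x)).
Proof. by move=> mA; exact: (@integrableD _ _ R mu A mA (EFin \o f) (EFin \o g)). Qed.

Lemma real_integrableB A f g : measurable A ->
  mu.-integrable A (EFin \o f) -> mu.-integrable A (EFin \o g) ->
  mu.-integrable A (EFin \o (fun x => f x - g x)).
Proof. by move=> mA; exact: (@integrableB _ _ R mu A mA (EFin \o f) (EFin \o g)). Qed.

End real_integrable.

Lemma measurable_normalized (R : realType) (rho : R) (l u : R -> R) :
    slowly_varying l -> measurable_fun (`]0, +oo[ : set R) u ->
  measurable_fun (`]0, +oo[ : set R)
    (fun x : R => u x / (x `^ (rho - 1) * l x)).
Proof.
move=> [ml l0 _] mu; apply: measurable_funM => //.
pose q (x : R) := x `^ (rho - 1) * l x.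
(* The reciprocal is written as the power [-1], which agrees with it for nonnegative [q] and is
   measurable. *)
apply: (@eq_measurable_fun _ _ _ _ _ (fun x => q x `^ (-1))).
  move=> x; rewrite inE/= in_itv/= andbT => x0.
  by rewrite powR_inv1// mulr_ge0 ?powR_ge0// ltW// l0.
apply: (@measurable_comp _ _ _ _ _ _ setT (fun y : R => y `^ (-1)) _ q) => //.
apply: measurable_funM => //; apply: measurable_funTS; exact: measurable_powR.
Qed.

(** * Replacing [u] by its limit profile on one block *)

(** The error splits into [(f y - p y) * (l y / l x)], controlled in mean, and
    [p y * (l y / l x - 1)], controlled by uniform convergence; both carry the weight [y]^ (rho -
    1)[, comparable to]x [^ (rho - 1)] on the block. *)
Lemma block_integral_equiv (R : realType) (r rho M X : R) (l u p : R -> R) :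
    1 < r -> 0 < rho -> slowly_varying l ->
    measurable_fun (`]0, +oo[ : set R) u -> measurable_fun (`]0, +oo[ : set R) p ->
    (forall x, 0 < x -> (@lebesgue_measure R).-integrable `]0, x] (EFin \o u)) ->
    let f x := u x / (x `^ (rho - 1) * l x) in
    (forall x, X <= x -> `|f x| <= M) -> (forall x, 0 < x -> 0 <= p x <= M) ->
    x^-1 * (\int[lebesgue_measure]_(y in `]x / r, x]) `|f y - p y|)
      @[x --> +oo] --> 0 ->
  (\int[lebesgue_measure]_(y in `]x / r, x]) u y) / (x `^ rho * l x) -
    x `^ (- rho) * (\int[lebesgue_measure]_(y in `]x / r, x]) (y `^ (rho - 1) * p y))
    @[x --> +oo] --> 0.
Proof.
move=> r1 rho0 svl mu mp iu f fM pM J0.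
have r0 : 0 < r by exact: lt_trans r1.
have [ml l0 _] := svl.
have M0 : 0 <= M by have /andP[] := pM 1 ltr01; exact: le_trans.
have mf : measurable_fun (`]0, +oo[ : set R) f by exact: measurable_normalized.
pose K := r `^ `|rho - 1|.
have K0 : 0 < K by exact: powR_gt0.
apply/cvgr0Pnorm_le => /= e e0.
(* The cap 1 gives [l y / l x <= 2]; the other term gives [K * (M * d) <= e / 2], with [M + 1]
   keeping the denominator positive. The tolerance [e / (4 * K)] below pays for the other half. *)
pose d := Num.min 1 (e / (2 * K * (M + 1))).
have d0 : 0 < d.
  by rewrite lt_min ltr01 divr_gt0// !mulr_gt0// ltr_wpDl.
have d1 : d <= 1 by rewrite ge_min lexx.
have dK : K * (M * d) <= e / 2.
  have : d <= e / (2 * K * (M + 1)) by rewrite ge_min lexx orbT.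
  rewrite ler_pdivlMr; last by rewrite !mulr_gt0// ltr_wpDl.
  have := mulr_gt0 K0 d0; nra.
have eK : 0 < e / (4 * K) by rewrite divr_gt0// mulr_gt0.
move/cvgr0Pnorm_le : J0 => /(_ _ eK)[X1 [_ JX1]].
have [X2 [_ lX2]] := slowly_varying_uniform svl r1 d0.
(* The factor [r] puts the whole block beyond [X], where [fM] applies. *)
pose T := Num.max (Num.max X1 X2) (r * Num.max X 1).
exists T; split; first exact: num_real.
move=> x; rewrite !gt_max -andbA => /and3P[/JX1 {}JX1 /lX2 {}lX2].
rewrite mulrC -ltr_pdivlMr// gt_max => /andP[Xx xr1].
have xr0 : 0 < x / r by rewrite (lt_trans _ xr1).
have x0 : 0 < x by rewrite -(divfK (negbT (gt_eqF r0)) x) mulr_gt0.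
have lx0 : 0 < l x by exact: l0.
pose h y := y `^ (rho - 1) * p y.
pose V := \int[lebesgue_measure]_(y in `]x / r, x]) u y.
pose Q := \int[lebesgue_measure]_(y in `]x / r, x]) h y.
pose I := \int[lebesgue_measure]_(y in `]x / r, x]) `|f y - p y|.
rewrite -/V -/Q; rewrite -/I in JX1.
have sub : `]x / r, x] `<=` (`]0, +oo[ : set R).
  by move=> y /=; rewrite !in_itv/= => /andP[/(lt_trans xr0)->].
have iV : (@lebesgue_measure R).-integrable `]x / r, x] (EFin \o u).
  apply: integrableS (iu x x0) => // y /=; rewrite !in_itv/= => /andP[/(lt_trans xr0)->].
  by move=> ->.
have iQ : (@lebesgue_measure R).-integrable `]x / r, x] (EFin \o h).
  exact: weight_integrable_block pM.
have iI : (@lebesgue_measure R).-integrable `]x / r, x] (EFin \o (fun y => `|f y - p y|)).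
  apply: (@bounded_integrable_itvoc _ _ _ _ (M + M)).
    apply: measurableT_comp => //; apply: measurable_funB.
      exact: measurable_funS mf.
    exact: measurable_funS mp.
  move=> y; rewrite in_itv/= => /andP[xy yx]; rewrite normr_id (le_trans (ler_normB _ _))//.
  have y0 := lt_trans xr0 xy; have /andP[p0 py] := pM y y0.
  by rewrite lerD// ?(ger0_norm p0)// fM// (le_trans (ltW Xx))// ltW.
pose k := K * x `^ (rho - 1).
have k0 : 0 <= k by rewrite mulr_ge0 ?powR_ge0 ?ltW.
have pw y : y \in `]x / r, x] ->
    `|u y / l x - h y| <= k * (2 * `|f y - p y| + M * d).
  rewrite in_itv/= => /andP[xy yx].
  have y0 := lt_trans xr0 xy.
  have g0 : 0 < y `^ (rho - 1) by exact: powR_gt0.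
  have -> : u y / l x - h y =
      y `^ (rho - 1) * ((f y - p y) * (l y / l x) + p y * (l y / l x - 1)).
    rewrite /h /f; have := l0 y y0; move: (y `^ _) g0 => g g0 ly0.
    by field; rewrite !gt_eqF.
  have := @powR_block _ r (rho - 1) x y r1 x0.
  rewrite (ltW xy) yx => /(_ isT)/andP[_ gk].
  rewrite normrM ger0_norm ?powR_ge0// ler_pM ?powR_ge0//.
  have /andP[p0 py] := pM y y0.
  have := lX2 y; rewrite (ltW xy) yx => /(_ isT) ld.
  move: (l y / l x) ld => lam ld.
  have lam2 : `|lam| <= 2.
    by have := ler_normD (lam - 1) 1; rewrite subrK normr1; lra.
  rewrite (le_trans (ler_normD _ _))// !normrM lerD//.
    by rewrite [2 * _]mulrC ler_wpM2l.
  by rewrite ler_pM// ger0_norm.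
have iul : (@lebesgue_measure R).-integrable `]x / r, x] (EFin \o (fun y => u y / l x)).
  have -> : (fun y => u y / l x) = (fun y => (l x)^-1 * u y).
    by apply/funext => y; rewrite mulrC.
  exact: real_integrableZl.
have iW : (@lebesgue_measure R).-integrable `]x / r, x] (EFin \o (fun y => u y / l x - h y)).
  exact: real_integrableB.
have iM : (@lebesgue_measure R).-integrable `]x / r, x] (EFin \o cst (M * d)).
  exact: (@bounded_integrable_itvoc _ _ _ _ `|M * d|).
have i2I : (@lebesgue_measure R).-integrable `]x / r, x]
    (EFin \o (fun y => 2 * `|f y - p y|)).
  exact: real_integrableZl.
have iS : (@lebesgue_measure R).-integrable `]x / r, x]
    (EFin \o (fun y => 2 * `|f y - p y| + M * d)).
  exact: real_integrableD.
have iR : (@lebesgue_measure R).-integrable `]x / r, x]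
    (EFin \o (fun y => k * (2 * `|f y - p y| + M * d))).
  exact: real_integrableZl.
have xrx : x / r <= x by rewrite ler_pdivrMr// ler_peMr// ltW.
have VQ : V / l x - Q = \int[lebesgue_measure]_(y in `]x / r, x]) (u y / l x - h y).
  by rewrite RintegralB// RintegralZr.
have VQle : `|V / l x - Q| <= k * (2 * I + M * d * x).
  rewrite VQ (le_trans (le_normr_Rintegral _ iW))//.
  apply: (@le_trans _ _ (\int[lebesgue_measure]_(y in `]x / r, x])
      (k * (2 * `|f y - p y| + M * d)))).
    apply: le_Rintegral => //; exact: (integrable_norm iW).
  rewrite RintegralZl// RintegralD// Rintegral_cst_itvoc// RintegralZl//.
  rewrite ler_wpM2l// lerD2l ler_wpM2l ?mulr_ge0 ?(ltW d0)//.
  by rewrite gerBl ltW.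
have xp : x `^ (- rho) * (x `^ (rho - 1) * x) = 1.
  rewrite [_ * x]mulrC mulr_powRB1 ?(ltW x0)// powRN mulVf//.
  by rewrite gt_eqF// powR_gt0.
have -> : V / (x `^ rho * l x) - x `^ (- rho) * Q = x `^ (- rho) * (V / l x - Q).
  by rewrite mulrBr powRN invfM mulrA [in LHS]mulrAC; ring.
rewrite normrM ger0_norm ?powR_ge0//.
apply: (@le_trans _ _ (K * (2 * (x^-1 * I) + M * d))).
  rewrite (le_trans (ler_wpM2l (powR_ge0 _ _) VQle))// /k.
  rewrite [leLHS](_ : _ = x `^ (- rho) * (x `^ (rho - 1) * x) * (K * (2 * (x^-1 * I) + M * d))).
    by rewrite xp mul1r.
  by field; rewrite gt_eqF.
move: JX1 => /(le_trans (ler_norm _)).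
rewrite ler_pdivlMr ?mulr_gt0// => JK.
by move: (x^-1 * I) (M * d) JK dK => *; lra.
Qed.

(** * Assembling the recursion and concluding *)

Theorem theorem2 (R : realType) (r rho : R) (l u p0 : R -> R)
  (hr : 1 < r) (hrho : 0 < rho)
  (hl : slowly_varying l)
  (hu0 : forall x : R, 0 <= x -> 0 <= u x)
  (hum : measurable_fun (`[0, +oo[ : set R) u)
  (hU : forall x : R, 0 <= x ->
    (\int[lebesgue_measure]_(y in `[0%R, x]) (u y)%:E < +oo)%E)
  (hp0 : periodicP r p0)
  (hlim : forall z, continuity_points p0 z ->
    u (r ^+ n * z) / ((r ^+ n * z) `^ (rho - 1) * l (r ^+ n * z))
      @[n --> \oo] --> p0 z)
  (hsup : (limf_esup (fun x : R => (u x / (x `^ (rho - 1) * l x))%:E) (+oo%R : set_system R)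
            < +oo)%E) :
  asymp_equiv
    (fun x => \int[lebesgue_measure]_(y in `[0, x]) u y)
    (fun x => x `^ rho * l x * B_op rho p0 x).
Proof.
have r0 : 0 < r by exact: lt_trans hr.
have [ml l0 _] := hl.
have [_ _ rcp _ pr] := hp0.
have [m [M1 [m0 pmM1]]] := periodicP_bounds hr hp0.
pose f x := u x / (x `^ (rho - 1) * l x).
have [M2 [X0 fM2]] := limf_esup_pinfty_bounded hsup.
pose M := Num.max M1 M2.
pose X := Num.max X0 1.
have X_gt0 : 0 < X by rewrite lt_max ltr01 orbT.
have fM x : X <= x -> `|f x| <= M.
  rewrite ge_max => /andP[X0x x1].
  have x0 : 0 < x by exact: lt_le_trans x1.
  rewrite ger0_norm; first by rewrite le_max fM2 ?orbT.
  by rewrite divr_ge0 ?hu0 ?mulr_ge0 ?powR_ge0// ltW// l0.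
have pmM x : 0 < x -> m <= p0 x <= M.
  by move=> /pmM1/andP[-> pM1]/=; rewrite le_max pM1.
have pM x : 0 < x -> 0 <= p0 x <= M.
  by move=> /pmM/andP[mp ->]; rewrite (le_trans (ltW m0) mp).
have pnM x : 0 < x -> `|p0 x| <= M.
  by move=> /pM/andP[? ?]; rewrite ger0_norm.
have mp : measurable_fun (`]0, +oo[ : set R) p0 by exact: right_continuous_measurable.
have mu0 : measurable_fun (`]0, +oo[ : set R) u.
  apply: measurable_funS hum => //.
  by move=> y /=; rewrite !in_itv/= !andbT => /ltW.
have iU x : 0 < x -> (@lebesgue_measure R).-integrable `]0, x] (EFin \o u).
  move=> x0; apply/integrableP; split.
    apply/measurable_EFinP; apply: measurable_funS mu0 => //.
    by move=> y /=; rewrite !in_itv/= => /andP[->].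
  apply: le_lt_trans (hU x (ltW x0)).
  rewrite [leLHS](_ : _ = \int[lebesgue_measure]_(y in `]0%R, x]) (u y)%:E)%E; last first.
    apply: eq_integral => y; rewrite inE/= in_itv/= => /andP[y0 _].
    by rewrite ger0_norm// hu0// ltW.
  apply: ge0_subset_integral => //.
  - apply/measurable_EFinP; apply: measurable_funS hum => //.
    by move=> y /=; rewrite !in_itv/= => /andP[->].
  - by move=> y /=; rewrite in_itv/= lee_fin => /andP[/hu0].
  - by move=> y /=; rewrite !in_itv/= => /andP[/ltW-> ->].
pose U x := \int[lebesgue_measure]_(y in `]0, x]) u y.
(* The endpoint 0 is a null set; [B_op] and the block lemmas use half-open intervals. *)
have UE x : 0 < x -> \int[lebesgue_measure]_(y in `[0, x]) u y = U x.
  by move=> x0; rewrite -Rintegral_itv_obnd_cbnd//; exact: iU.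
have U0 x : 0 <= U x.
  by apply: Rintegral_ge0 => y /=; rewrite in_itv/= => /andP[/ltW/hu0].
have leU x y : 0 < x -> x <= y -> U x <= U y.
  move=> x0 xy; apply: ge0_subset_Rintegral => //.
  - by apply: iU; exact: lt_le_trans xy.
  - by move=> z /=; rewrite in_itv/= => /andP[/ltW/hu0].
  - by move=> z /=; rewrite !in_itv/= => /andP[-> zx]; exact: le_trans xy.
have aef : {ae @lebesgue_measure R,
    forall z, 0 < z -> f (r ^+ n * z) @[n --> \oo] --> p0 z}.
  pose D := [set x : R | 0 < x /\ ~ {for x, continuous p0}].
  have cD : countable D by exact: right_continuous_discontinuity_countable.
  exists D; split.
  - by apply: countable_measurable => // x; exact: measurable_set1.
  - exact: countable_lebesgue_measure0.
  - move=> z /= /not_implyP[z0 nfz]; split => // cz; apply: nfz.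
    exact: hlim.
have J0 := block_mean_cvg0 hr (measurable_normalized rho hl mu0) mp fM pnM pr aef.
have V0 := block_integral_equiv hr hrho hl mu0 mp iU fM pM J0.
have [c [C [c0 BcC]]] := B_op_bounds hr hrho m0 mp pmM pr.
pose B := B_op rho p0.
have rec x := @B_op_recursion _ r rho M p0 x hr hrho.
pose th := r `^ (- rho).
have th0 : 0 < th by exact: powR_gt0.
have th1 : th < 1.
  rewrite /th powRN invf_lt1 ?powR_gt0//.
  by rewrite /powR gt_eqF// -expR0 ltr_expR mulr_gt0// ln_gt0.
pose W x := U x / (x `^ rho * l x).
pose ka x := l (x / r) / l x.
(* Subtracting [B x = th * B x + ...] from the split form of [W x] leaves
   [th * ka x * B x - th * B x], the first term, and the block difference, the second. *)
pose b x := th * ((ka x - 1) * B x) +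
  ((\int[lebesgue_measure]_(y in `]x / r, x]) u y) / (x `^ rho * l x) -
    x `^ (- rho) * (\int[lebesgue_measure]_(y in `]x / r, x])
      (y `^ (rho - 1) * p0 y))).
have ka1 : ka x @[x --> +oo] --> (1 : R).
  have [_ _ /(_ r^-1)] := hl; rewrite invr_gt0 => /(_ r0).
  rewrite (_ : (fun x => l (r^-1 * x) / l x) = ka)//.
  by apply/funext => x; rewrite /ka [x / r]mulrC.
have C0 : 0 < C by have /andP[/(lt_le_trans c0) h /(lt_le_trans h)] := BcC 1 ltr01.
have b0 : b x @[x --> +oo] --> 0.
  rewrite -[0]addr0; apply: cvgD V0.
  apply/cvgr0Pnorm_le => e e0.
  have eC : 0 < e / C by exact: divr_gt0.
  move/cvgrPdist_le : ka1 => /(_ _ eC)[A [_ hA]].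
  exists (Num.max A 0); split; first exact: num_real.
  move=> x; rewrite gt_max => /andP[/hA {}hA x0].
  have /andP[cB BC] : c <= B x <= C by exact: BcC.
  have : 0 <= B x by rewrite (le_trans (ltW c0)).
  move: (B x) BC => Bx BC B0.
  rewrite !normrM (gtr0_norm th0) (ger0_norm B0) [`|_ - 1|]distrC.
  rewrite ler_pdivlMr// in hA.
  apply: le_trans hA; rewrite -[leRHS]mul1r ler_pM ?mulr_ge0 ?(ltW th0) ?(ltW th1)//.
  exact: ler_wpM2l.
have E0 : W x - B x @[x --> +oo] --> 0.
  (* The contraction constant is the midpoint of [th] and 1, available since [ka] tends to 1. *)
  have : \forall x \near +oo, `|th * ka x| <= (1 + th) / 2.
    have d0 : 0 < (1 - th) / 2 by lra.
    move/cvgrPdist_le : ka1 => /(_ _ d0); apply: filterS => x hx.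
    rewrite normrM (gtr0_norm th0).
    have k1 : `|ka x| <= 1 + (1 - th) / 2.
      by have := ler_normD (ka x - 1) 1; rewrite subrK normr1 distrC; lra.
    have := ler_wpM2l (ltW th0) k1; nra.
  (* Tolerance 1 is enough here: it gives [l T <= 2 * l x] for [x] in [[T, r * T]]. *)
  have := slowly_varying_uniform hl hr ltr01.
  move=> [X1 [_ hX1]] [X2 [_ hX2]].
  pose T0 := Num.max X (Num.max X1 X2 + 1).
  have T00 : 0 < T0 by rewrite lt_max X_gt0.
  apply: (@contraction_cvg0 _ r ((1 + th) / 2) T0 (fun x => th * ka x) b) => //.
  - apply/andP; split; lra.
  - move=> T T0T; have Tpos : 0 < T by exact: lt_le_trans T0T.
    have lT := l0 T Tpos.
    exists (U (r * T) / (T `^ rho * (l T / 2)) + C) => x /andP[Tx xT].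
    have x0 : 0 < x by exact: lt_le_trans Tx.
    have lx := l0 x x0.
    have /andP[cB BC] : c <= B x <= C by exact: BcC.
    have B0 : 0 <= B x by rewrite (le_trans (ltW c0)).
    rewrite (le_trans (ler_normB _ _))// lerD//; last by rewrite ger0_norm.
    have : `|l T / l x - 1| <= 1.
      apply: hX1; last by rewrite Tx andbT ler_pdivrMr// mulrC.
      rewrite (lt_le_trans _ Tx)// (lt_le_trans _ T0T)// lt_max; apply/orP; right.
      by rewrite ltr_pwDr// le_max lexx.
    move=> /(le_trans (ler_norm _)); rewrite lerBlDr ler_pdivrMr// => lTx.
    have Trho : 0 < T `^ rho by exact: powR_gt0.
    have xrho : 0 < x `^ rho by exact: powR_gt0.
    have Txrho : T `^ rho <= x `^ rho.
      by apply: ge0_ler_powR => //; rewrite ?nnegrE; exact: ltW.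
    rewrite ger0_norm; last by rewrite divr_ge0// ltW// mulr_gt0.
    apply: ler_pM => //; first by rewrite invr_ge0 ltW// mulr_gt0.
      exact: leU.
    rewrite lef_pV2 ?posrE ?mulr_gt0// ?divr_gt0//.
    by rewrite ler_pM ?(ltW Trho)// ?divr_ge0 ?(ltW lT)//; lra.
  - move=> x; rewrite ge_max => /andP[_ xX]; apply: hX2.
    by rewrite (lt_le_trans _ xX)// ltr_pwDr// le_max lexx orbT.
  - move=> x T0x; have x0 : 0 < x by exact: lt_le_trans T0x.
    have xr0 : 0 < x / r by exact: divr_gt0.
    have lx := l0 x x0; have lxr := l0 _ xr0.
    have Bxr : B (x / r) = B x by exact: B_op_scale pM pr.
    have Ux : U x = U (x / r) + \int[lebesgue_measure]_(y in `]x / r, x]) u y.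
      by apply: Rintegral_itvoc_split => //; exact: iU.
    have xth : (x / r) `^ rho = th * x `^ rho.
      rewrite powRM ?invr_ge0 ?(ltW r0) ?(ltW x0)// mulrC; congr (_ * _).
      by rewrite -[in LHS]powR_inv1 ?(ltW r0)// -powRrM mulN1r.
    have xrho : 0 < x `^ rho by exact: powR_gt0.
    have := rec x x0 mp pM pr; rewrite -/th -/B.
    rewrite /b /W Bxr xth Ux /ka.
    set Q := \int[lebesgue_measure]_(y in `]x / r, x]) (y `^ (rho - 1) * p0 y).
    move=> BQ.
    rewrite [in LHS]BQ; field.
    by rewrite !gt_eqF.
rewrite /asymp_equiv; apply/cvgrPdist_le => e e0.
(* The relative error is [(W x - B x) / B x], and [B x] is at least [c]. *)
have ec : 0 < e * c by exact: mulr_gt0.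
move/cvgr0Pnorm_le : E0 => /(_ _ ec)[A [_ hA]].
exists (Num.max A 0); split; first exact: num_real.
move=> x; rewrite gt_max => /andP[/hA {}hA x0].
have /andP[cB _] : c <= B x <= C by exact: BcC.
have B0 : 0 < B x by exact: lt_le_trans cB.
have lx := l0 x x0; have xrho : 0 < x `^ rho by exact: powR_gt0.
rewrite UE// distrC -/(B x).
have -> : U x / (x `^ rho * l x * B x) - 1 = (W x - B x) / B x.
  by rewrite /W; field; rewrite !gt_eqF.
rewrite normrM normfV (gtr0_norm B0) ler_pdivrMr// (le_trans hA)//.
by rewrite ler_pM2l.
Qed.
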